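(* The sequence $x_\beta=(x_\beta(N))_{N\ge 0}$, where $x_\beta(N)=s_\beta(N) \bmod 2\in\{0,1\}$ is the sum of digits modulo 2 of the base phi expansion of $N$, is a morphic sequence, i.e., it is the letter-to-letter image of a fixed point of a morphism.
   Context: Let $\varphi=(1+\sqrt5)/2$ be the golden mean. Every integer $N\ge 0$ can be written uniquely as $N=\sum_{i\in\mathbb Z} d_i\varphi^i$ with digits $d_i=d_i(N)\in\{0,1\}$, only finitely many of them nonzero, and with $d_id_{i+1}=0$ for all $i$ (no two consecutive digits both equal to 1). This is the base phi expansion of $N$. The sum of digits function is $s_\beta(N)=\sum_{i} d_i(N)$, and $x_\beta(N)\in\{0,1\}$ is $s_\beta(N)$ reduced modulo 2. A morphism over a finite alphabet $A$ is a map $\tau$ sending letters to finite words over $A$ and extended to finite and infinite words by concatenation. A fixed point of $\tau$ is an infinite word $t=t_0t_1t_2\dots$ over $A$ with $\tau(t)=t$. A sequence $(x(N))_{N\ge0}$ over $\{0,1\}$ is morphic if there are a finite alphabet $A$, a morphism $\tau$ over $A$ with an infinite fixed point $t$ obtained by iteration from its first letter $a$ (i.e. $\tau(a)$ begins with $a$ and $t=\lim_n\tau^n(a)$), and a map $\lambda:A\to\{0,1\}$ such that $x(N)=\lambda(t_N)$ for all $N\ge0$. *)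

(* Defs.v *)
From HB Require Import structures.
From mathcomp Require Import all_boot all_order all_algebra finmap.
From mathcomp Require Import all_classical all_reals.

Set Implicit Arguments.
Unset Strict Implicit.
Unset Printing Implicit Defensive.

Import Order.TTheory GRing.Theory Num.Theory.

Local Open Scope classical_set_scope.
Local Open Scope ring_scope.

(* The set {0,1}, of digits and of residues modulo 2, is represented by bool,
   with its usual coercion to nat (false is 0, true is 1). *)

Definition golden_mean (R : realType) : R := (1 + Num.sqrt 5) / 2.

(* Digit families indexed by all integers, with finitely many nonzero digits. *)
Definition digits := {fsfun int -> bool with false}.

Definition base_phi_expansion (R : realType) (N : nat) (d : digits) : Prop :=
  N%:R = \sum_(i <- finsupp d) (d i)%:R * golden_mean R ^ i /\
  (forall i : int, ~~ (d i && d (i + 1))).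

(* The expansion exists and is unique for every N, so xget selects it and the
   default value [fsfun] is never used. *)
Definition base_phi (R : realType) (N : nat) : digits :=
  xget [fsfun] [set d | base_phi_expansion R N d].

Definition s_beta (R : realType) (N : nat) : nat :=
  (\sum_(i <- finsupp (base_phi R N)) base_phi R N i)%N.

Definition x_beta (R : realType) (N : nat) : bool := odd (s_beta R N).

Section Morphic.
Variable A : finType.

Definition morph_word (tau : A -> seq A) (w : seq A) : seq A :=
  flatten (map tau w).

(* The finite words w n converge to the infinite word t: each position k of w n
   is eventually defined and equal to t k. *)
Definition words_converge (w : nat -> seq A) (t : nat -> A) : Prop :=
  forall k : nat, exists M : nat, forall n : nat, (M <= n)%N ->
    onth (w n) k = Some (t k).

(* tau(t) = u for infinite words: u is the infinite concatenation
   tau(t_0) tau(t_1) tau(t_2) and so on.  Since tau may erase letters, this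
   concatenation may be finite, in which case there is no such u. *)
Definition morph_infinite_word (tau : A -> seq A) (t u : nat -> A) : Prop :=
  words_converge (fun n => morph_word tau (mkseq t n)) u.

Definition fixed_point (tau : A -> seq A) (t : nat -> A) : Prop :=
  morph_infinite_word tau t t.

Definition iterated_fixed_point (tau : A -> seq A) (a : A) (t : nat -> A) :
    Prop :=
  [/\ fixed_point tau t, t 0%N = a, prefix [:: a] (tau a) &
      words_converge (fun n => iter n (morph_word tau) [:: a]) t].

End Morphic.

Definition morphic (x : nat -> bool) : Prop :=
  exists (A : finType) (tau : A -> seq A) (a : A) (t : nat -> A)
         (lambda : A -> bool),
    iterated_fixed_point tau a t /\ (forall N : nat, x N = lambda (t N)).

(* Main.v *)
Require Import Defs.
From mathcomp Require Import all_boot all_order all_algebra all_reals.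
From HB Require Import structures.
From mathcomp Require Import finmap classical_sets zify ring lra.

Set Implicit Arguments.
Unset Strict Implicit.
Unset Printing Implicit Defensive.

Import Order.TTheory GRing.Theory Num.Theory.

(** For even h, let A be the word of the parities x_beta(N) for N in
    [0, L_(h+1)], where L_m = phi^m + (-1/phi)^m is a Lucas number, and let B be
    the word for the integers strictly between L_(h+1) and L_(h+2).  Replacing
    h by h + 2 changes (A, B) into (A B A, B' A' B'), where A' is the value of A
    for h - 2 and B' is B with all bits flipped:

    - adding L_(h+2) = phi^(h+2) + phi^(-(h+2)) to an integer of [0, L_(h+1)]
      puts two isolated digits 1 around its expansion, so the parities of A
      recur on [L_(h+2), L_(h+3)];
    - an integer L_(h+1) + k with 0 < k < L_h has expansion
      phi^(h+1) + w + phi^(-(h+2)), where the inner part w represents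
      k - phi^(-h).  The inner parts of the next level come from those of this
      level by one more digit 1 (at the bottom for the smallest k, at the top
      for the largest k), and in between from [0, L_(h-1)] by two more digits.

    These relations are block_words_next.  They determine the parities because
    an expansion without consecutive digits 1 is unique (digit_value_inj): such
    digits in positions below n sum to less than phi^n.

    The recursion is a morphism on signed blocks, with a third block for A', and
    x_beta is the limit of the words which decode its iterates on A.  The
    decoding replaces letters by words rather than by single bits;
    morphic_image turns it into a letter-to-letter coding. *)

(** * Words decoded from the iterates of a morphism *)

Lemma morph_word_cat (A : finType) (tau : A -> seq A) (w1 w2 : seq A) :
  morph_word tau (w1 ++ w2) = morph_word tau w1 ++ morph_word tau w2.
Proof. by rewrite /morph_word map_cat flatten_cat. Qed.

Section ImageOfFixedPoint.
Variables (A : finType) (tau : A -> seq A) (f : A -> seq bool).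

(** A letter b is spelled by the values in the word f b, each with its letter of
    origin; the flag marks the first one, which alone carries the action of the
    morphism. *)
Definition marked_block (b : A) : seq (A * bool * bool) :=
  if f b is v :: vs then (b, true, v) :: [seq (b, false, v') | v' <- vs]
  else [::].

Definition marked_word (w : seq A) := flatten (map marked_block w).

(** Marked letters produce the image of the whole block and the others are
    erased, so that blocks are mapped to blocks whatever their lengths. *)
Definition marked_morphism (l : A * bool * bool) : seq (A * bool * bool) :=
  if l.1.2 then marked_word (tau l.1.1) else [::].

Lemma marked_word_cat w1 w2 :
  marked_word (w1 ++ w2) = marked_word w1 ++ marked_word w2.
Proof. by rewrite /marked_word map_cat flatten_cat. Qed.

Lemma value_marked_word w :
  [seq l.2 | l <- marked_word w] = flatten (map f w).
Proof.
elim: w => //= b w IHw; rewrite /marked_word /= map_cat -/(marked_word w) IHw.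
congr (_ ++ _); rewrite /marked_block; case: (f b) => //= v vs.
by rewrite -map_comp map_id.
Qed.

Hypothesis f_neq0 : forall b, f b != [::].

(** A block keeps its unique marked letter because f erases no letter. *)
Lemma marked_morphism_block b :
  morph_word marked_morphism (marked_block b) = marked_word (tau b).
Proof.
rewrite /marked_block; have := f_neq0 b; case: (f b) => //= v vs _.
rewrite -cat1s morph_word_cat {1}/morph_word /= cats0.
suff -> : morph_word marked_morphism [seq (b, false, v') | v' <- vs] = [::].
  by rewrite cats0.
by elim: vs.
Qed.

Lemma marked_morphism_word w :
  morph_word marked_morphism (marked_word w) = marked_word (morph_word tau w).
Proof.
elim: w => // b w IHw.
rewrite -[b :: w]cat1s marked_word_cat (morph_word_cat marked_morphism) IHw.
rewrite (morph_word_cat tau) marked_word_cat; congr (_ ++ _).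
rewrite {1}/marked_word /= cats0 marked_morphism_block.
by rewrite /morph_word /= cats0.
Qed.

(** The words spelled by the iterates of tau are prefixes of one another, of
    unbounded lengths, and marked_morphism maps each one to the next: their
    limit is its fixed point, and its third components spell x. *)
Lemma morphic_image (a : A) (x : nat -> bool) :
    prefix [:: a] (tau a) ->
    (forall n, let w := flatten (map f (iter n (morph_word tau) [:: a])) in
      (n < size w)%N /\ w = mkseq x (size w)) ->
  morphic x.
Proof.
move=> tau_a image_x.
pose u n := marked_word (iter n (morph_word tau) [:: a]).
have value_u n : map snd (u n) = mkseq x (size (u n)).
  have [_] := image_x n; rewrite -value_marked_word -/(u n) => {1}->.
  by rewrite size_map.
have size_u n : (n < size (u n))%N.
  by have [+ _] := image_x n; rewrite -value_marked_word size_map.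
have uS n : u n.+1 = morph_word marked_morphism (u n).
  by rewrite marked_morphism_word.
have u_prefix n m : exists w, u (n + m)%N = u n ++ w.
  have uSn k : exists w, u k.+1 = u k ++ w.
    elim: k => [|k [w IHk]]; last first.
      by exists (morph_word marked_morphism w); rewrite uS {1}IHk morph_word_cat -uS.
    case/prefixP: tau_a => w tau_aE; exists (marked_word w).
    by rewrite -marked_word_cat -tau_aE /u /= /morph_word /= cats0.
  elim: m => [|m [w IHm]]; first by exists [::]; rewrite addn0 cats0.
  have [w' unm] := uSn (n + m)%N; exists (w ++ w').
  by rewrite addnS unm IHm catA.
pose t k := nth (a, true, true) (u k) k.
have nth_u n k : (k < size (u n))%N -> nth (a, true, true) (u n) k = t k.
  move=> ltk; have [w uw] := u_prefix n k; have [w' uw'] := u_prefix k n.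
  have: nth (a, true, true) (u n ++ w) k = nth (a, true, true) (u k ++ w') k.
    by rewrite -uw -uw' addnC.
  by rewrite !nth_cat ltk size_u.
have onth_u n k : (k < size (u n))%N -> onth (u n) k = Some (t k).
  by move=> ltk; rewrite -(nth_u n) // onthE (nth_map (a, true, true)).
have mkseq_t n : mkseq t (size (u n)) = u n.
  apply: (@eq_from_nth _ (a, true, true)) => [|k]; rewrite size_mkseq // => ltk.
  by rewrite nth_mkseq // nth_u.
exists (A * bool * bool)%type, marked_morphism, (t 0%N), t, snd.
have u1 : u 1%N = marked_morphism (t 0%N).
  rewrite uS /t /u /= /marked_word /= cats0 marked_morphism_block /marked_block.
  by have := f_neq0 a; case: (f a).
split; last first.
  move=> N; have /(congr1 (fun s => nth false s N)) := value_u N.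
  by rewrite nth_mkseq // (nth_map (a, true, true)).
split=> // [k||k].
- exists (size (u k)) => n le_n; rewrite -(subnKC le_n).
  rewrite /mkseq iotaD map_cat -/(mkseq t _) mkseq_t morph_word_cat -uS onth_cat.
  by rewrite (ltn_trans (ltnSn k) (size_u k.+1)) onth_u // (ltn_trans _ (size_u k.+1)).
- rewrite -u1; have := mkseq_t 1%N; have := size_u 1%N.
  by case: (size (u 1%N)) => // n _ <-; rewrite /= /mkseq /= eqxx prefix0s.
exists k.+1 => -[|n] // le_n.
suff -> : iter n.+1 (morph_word marked_morphism) [:: t 0%N] = u n.+1.
  by rewrite onth_u // (ltn_trans le_n (size_u n.+1)).
elim: n {k le_n} => [|n IHn]; first by rewrite /= u1 /morph_word /= cats0.
by rewrite iterS IHn -uS.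
Qed.

End ImageOfFixedPoint.

(** * The morphism on signed blocks *)

(** With A, B, A' as above, the blocks stand for A, B and A' in this order. *)
Variant block := LowBlock | CoreBlock | PreviousBlock.

Definition block_code (b : block) : option bool :=
  match b with
  | LowBlock => None | CoreBlock => Some false | PreviousBlock => Some true
  end.

Definition block_decode (o : option bool) : block :=
  match o with
  | None => LowBlock | Some false => CoreBlock | Some true => PreviousBlock
  end.

Lemma block_codeK : cancel block_code block_decode. Proof. by case. Qed.

HB.instance Definition _ := Finite.copy block (can_type block_codeK).

Definition block_split (b : block) : seq (block * bool) :=
  match b with
  | LowBlock => [:: (LowBlock, false); (CoreBlock, false); (LowBlock, false)]
  | CoreBlock => [:: (CoreBlock, true); (PreviousBlock, false); (CoreBlock, true)]
  | PreviousBlock => [:: (LowBlock, false)]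
  end.

(** The boolean of a letter tells whether the bits of the block are flipped;
    flipping a block flips all the blocks into which it splits. *)
Definition block_morphism (l : block * bool) : seq (block * bool) :=
  [seq (l'.1, l.2 (+) l'.2) | l' <- block_split l.1].

Section BlockWords.
Implicit Types W : block -> seq bool.

Definition signed_word W (l : block * bool) : seq bool := map (addb l.2) (W l.1).

Definition next_words W (b : block) : seq bool :=
  flatten (map (signed_word W) (block_split b)).

Lemma signed_word_false W b : signed_word W (b, false) = W b.
Proof. by rewrite /signed_word -[RHS]map_id; apply: eq_map; case. Qed.

Lemma next_wordsE W :
  [/\ next_words W LowBlock = W LowBlock ++ W CoreBlock ++ W LowBlock,
    next_words W CoreBlock = map negb (W CoreBlock) ++ W PreviousBlock
      ++ map negb (W CoreBlock) &
    next_words W PreviousBlock = W LowBlock].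
Proof. by split; rewrite /next_words /= ?signed_word_false cats0. Qed.

(** Applying the morphism and then decoding by W is decoding by the next words,
    so that iterating the morphism amounts to iterating the recursion on
    words. *)
Lemma signed_word_next W w :
  flatten (map (signed_word W) (morph_word block_morphism w)) =
  flatten (map (signed_word (next_words W)) w).
Proof.
elim: w => // l w IHw; rewrite -[l :: w]cat1s morph_word_cat !map_cat !flatten_cat.
rewrite {}IHw; congr (_ ++ _); rewrite /morph_word /= !cats0.
rewrite {2}/signed_word /next_words map_flatten -map_comp /block_morphism -map_comp.
congr flatten; apply: eq_map => l' /=; rewrite /signed_word -map_comp /=.
by apply: eq_map => v /=; rewrite addbA.
Qed.

Lemma signed_word_iter W n w :
  flatten (map (signed_word W) (iter n (morph_word block_morphism) w)) =
  flatten (map (signed_word (iter n next_words W)) w).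
Proof.
elim: n W => // n IHn W.
by rewrite iterS signed_word_next IHn -iterSr.
Qed.

Lemma size_iter_next_words W n :
  (0 < size (W LowBlock))%N -> (n < size (iter n next_words W LowBlock))%N.
Proof.
move=> W_gt0; elim: n => // n IHn.
have [lowE _ _] := next_wordsE (iter n next_words W); rewrite iterS lowE !size_cat; lia.
Qed.

End BlockWords.

Local Open Scope ring_scope.

(** * Uniqueness of base phi expansions *)

Section BasePhi.
Variable R : realType.
Local Notation phi := (golden_mean R).

Lemma golden_mean_gt1 : 1 < phi.
Proof.
rewrite /golden_mean; have : 1 < Num.sqrt 5 :> R; last lra.
by rewrite -[ltLHS]sqrtr1 ltr_sqrt; lra.
Qed.

Lemma golden_mean_sqr : phi ^+ 2 = phi + 1.
Proof.
have h : Num.sqrt 5 ^+ 2 = 5 :> R by rewrite sqr_sqrtr.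
by rewrite /golden_mean; move: h; set s := Num.sqrt 5; rewrite !expr2 => h; lra.
Qed.

Lemma golden_mean_gt0 : 0 < phi. Proof. exact: lt_trans golden_mean_gt1. Qed.

Lemma golden_mean_exp_rec (i j k : int) :
  j = i + 1 -> k = i + 2 -> phi ^ k = phi ^ j + phi ^ i.
Proof.
have phi0 := lt0r_neq0 golden_mean_gt0.
move=> -> ->.
by rewrite !expfzDr // expr1z -expr2 golden_mean_sqr mulrDr mulr1.
Qed.

Definition admissible (d : digits) : Prop :=
  forall i : int, ~~ (d i && d (i + 1)).

Definition digit_value (d : digits) : R :=
  \sum_(i <- finsupp d) (d i)%:R * phi ^ i.

Definition digit_count (d : digits) : nat := (\sum_(i <- finsupp d) d i)%N.

(** When the top digit n + 1 is 1, the digit n is 0, and the bound is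
    phi^(n+1) + phi^n = phi^(n+2); this needs the two previous bounds. *)
Lemma admissible_sum_lt (g : nat -> bool) n :
  (forall i, ~~ (g i && g i.+1)) -> \sum_(i < n) (g i)%:R * phi ^+ i < phi ^+ n.
Proof.
move=> g_adm; have phi_gt1 := golden_mean_gt1; have phi_gt0 := golden_mean_gt0.
have [//] : (\sum_(i < n) (g i)%:R * phi ^+ i < phi ^+ n) /\
  (\sum_(i < n.+1) (g i)%:R * phi ^+ i < phi ^+ n.+1).
elim: n => [|n [IHn IHn1]].
  rewrite big_ord_recl !big_ord0 expr0 expr1; split; first lra.
  by case: (g _) => /=; lra.
split=> //; have expS2 : phi ^+ n.+2 = phi ^+ n.+1 + phi ^+ n.
  by rewrite -addn2 exprD golden_mean_sqr mulrDr mulr1 -exprSr.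
have := g_adm n; rewrite big_ord_recr /=; case g_n1: (g n.+1); last first.
  by rewrite mul0r addr0 expS2 => _; have := exprn_gt0 n phi_gt0; lra.
rewrite andbT big_ord_recr /= => /negbTE ->.
by rewrite mul0r addr0 mul1r expS2; lra.
Qed.

(** By admissible_sum_lt a top digit 1 outweighs all the digits below it, so top
    digits agree and can be cancelled. *)
Lemma admissible_sum_inj (g h : nat -> bool) n :
    (forall i, ~~ (g i && g i.+1)) -> (forall i, ~~ (h i && h i.+1)) ->
    \sum_(i < n) (g i)%:R * phi ^+ i = \sum_(i < n) (h i)%:R * phi ^+ i ->
  forall i, (i < n)%N -> g i = h i.
Proof.
move=> g_adm h_adm; elim: n => // n IHn; rewrite !big_ord_recr /=.
have sum_ge0 (k : nat -> bool) : 0 <= \sum_(i < n) (k i)%:R * phi ^+ i.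
  apply: sumr_ge0 => i _; rewrite mulr_ge0 ?ler0n ?exprn_ge0 //.
  exact: ltW golden_mean_gt0.
have := admissible_sum_lt n g_adm; have := admissible_sum_lt n h_adm.
have := sum_ge0 g; have := sum_ge0 h.
move=> h0 g0 hlt glt sumE.
have gh_n : g n = h n.
  by case: (g n) (h n) sumE => -[] //=; rewrite mul1r mul0r; lra.
move=> i; rewrite ltnS leq_eqVlt => /orP[/eqP-> //|]; apply: IHn.
by move: sumE; rewrite gh_n => /addIr.
Qed.

(** Multiplying by phi^m moves a window of integer positions to the natural
    numbers, where the sums can be studied by induction. *)
Lemma digit_value_window (d : digits) (m n : nat) :
    (forall i, d i -> - m%:Z <= i < n%:Z - m%:Z) ->
  digit_value d * phi ^+ m = \sum_(j < n) (d (j%:Z - m%:Z))%:R * phi ^+ j.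
Proof.
move=> d_win; have phi0 := lt0r_neq0 golden_mean_gt0.
pose S := [fset (j : nat)%:Z - m%:Z | j in iota 0 n]%fset.
have -> : digit_value d = \sum_(i <- S) (d i)%:R * phi ^ i.
  apply: big_fset_incl => [|i _].
    apply/fsubsetP => i; rewrite mem_finsupp => di.
    have {}di : d i by case: (d i) di.
    have := d_win _ di => i_win; apply/imfsetP; exists (absz (i + m%:Z)) => /=; last lia.
    by rewrite mem_iota; lia.
  by rewrite mem_finsupp negbK => /eqP ->; rewrite mul0r.
rewrite big_imfset => [|i j _ _ /addIr[] //].
rewrite /= big_distrl /= undup_id ?iota_uniq //.
rewrite -[X in iota 0 X]subn0 -/(index_iota 0 n) big_mkord.
by apply: eq_bigr => j _; rewrite -mulrA !exprnP -expfzDr // subrK.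
Qed.

Lemma digit_value_inj (d e : digits) :
  admissible d -> admissible e -> digit_value d = digit_value e -> d = e.
Proof.
move=> d_adm e_adm de.
have [m m_max] : exists m : nat, forall i, d i || e i -> - m%:Z <= i <= m%:Z.
  exists (\max_(i <- (finsupp d `|` finsupp e)%fset) `|i|%N)%N => i dei.
  suff: (`|i| <= \max_(i <- (finsupp d `|` finsupp e)%fset) `|i|)%N by lia.
  apply: leq_bigmax_seq => //; rewrite in_fsetU !mem_finsupp.
  by move: dei; case: (d i); case: (e i).
have win (c : digits) : (forall i, c i -> - m%:Z <= i <= m%:Z) ->
    forall i, c i -> - m%:Z <= i < (m + m).+1%:Z - m%:Z.
  by move=> c_max i /c_max; lia.
have adm (c : digits) : admissible c ->
    forall j : nat, ~~ (c (j%:Z - m%:Z) && c (j.+1%:Z - m%:Z)).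
  move=> c_adm j; have := c_adm (j%:Z - m%:Z).
  by rewrite (_ : j%:Z - m%:Z + 1 = j.+1%:Z - m%:Z) //; lia.
have dwin i : d i -> - m%:Z <= i <= m%:Z by move=> di; rewrite m_max ?di.
have ewin i : e i -> - m%:Z <= i <= m%:Z by move=> ei; rewrite m_max ?ei ?orbT.
have /(admissible_sum_inj (adm _ d_adm) (adm _ e_adm)) eq_win :
    \sum_(j < (m + m).+1) (d (j%:Z - m%:Z))%:R * phi ^+ j =
    \sum_(j < (m + m).+1) (e (j%:Z - m%:Z))%:R * phi ^+ j.
  by rewrite -!digit_value_window ?de //; apply: win.
apply/fsfunP => i; case: (boolP (d i || e i)) => [/m_max i_win | ].
  have := eq_win (absz (i + m%:Z)); rewrite (_ : (absz (i + m%:Z))%:Z - m%:Z = i); last lia.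
  by apply; lia.
by case: (d i); case: (e i).
Qed.

(** * Representations with digits in a window *)

(** The window records where further digits 1 can be added without creating two
    consecutive ones.  Real values v occur besides integers, as inner parts of
    expansions. *)
Definition represents (lo hi : int) (v : R) (b : bool) : Prop :=
  exists d : digits, [/\ admissible d, forall i, d i -> lo <= i <= hi,
    digit_value d = v & odd (digit_count d) = b].

Lemma x_beta_represents lo hi N b : represents lo hi N%:R b -> x_beta R N = b.
Proof.
move=> [d [d_adm _ d_val <-]]; rewrite /x_beta /s_beta.
have d_exp : base_phi_expansion R N d by [].
have [e_val e_adm] : base_phi_expansion R N (base_phi R N).
  by rewrite /base_phi; case: xgetP => [_ -> //|/(_ d)].
have -> // : base_phi R N = d.
by apply: digit_value_inj => //; apply: etrans (esym d_val).
Qed.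

Lemma represents0 lo hi : represents lo hi 0 false.
Proof.
by exists [fsfun]; split=> [i|i||]; rewrite ?fsfunE // /digit_value /digit_count
  finsupp0 big_seq_fset0.
Qed.

Lemma represents_widen lo hi lo' hi' v b :
  lo' <= lo -> hi <= hi' -> represents lo hi v b -> represents lo' hi' v b.
Proof.
by move=> lolo' hihi' [d [d_adm d_win d_val d_odd]]; exists d; split=> // i /d_win; lia.
Qed.

Lemma represents_insert k lo hi v b :
    represents lo hi v b -> k + 2 <= lo \/ hi + 2 <= k ->
  represents (Order.min lo k) (Order.max hi k) (v + phi ^ k) (~~ b).
Proof.
move=> [d [d_adm d_win <- <-]] k_out.
pose e : digits := [fsfun d with k |-> true]%fsfun.
have eE i : e i = (i == k) || d i by rewrite /e fsfun_withE; case: eqP.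
have dF i : i < lo \/ hi < i -> d i = false.
  by case di: (d i) => //; have := d_win _ di; lia.
have supp_e : finsupp e = (k |` finsupp d)%fset.
  by apply/fsetP => i; rewrite !inE !mem_finsupp eE; case: (i == k).
have kd : k \notin finsupp d by rewrite mem_finsupp dF //; lia.
have e_out i : i \in finsupp d -> e i = d i.
  by rewrite eE; case: eqP => // -> kd'; rewrite kd' in kd.
exists e; split=> [i|i||].
- rewrite !eE; case: (altP (i =P k)) => [->|i_k].
    by rewrite (dF (k + 1)) ?orbF /=; lia.
  case: (altP (i + 1 =P k)) => [ik|_] /=; last exact: d_adm.
  by rewrite (dF i) //; lia.
- rewrite eE => /orP[/eqP->|/d_win]; lia.
- rewrite /digit_value supp_e big_fsetU1 //= eE eqxx mul1r addrC.
  by congr (_ + _); rewrite big_seq [RHS]big_seq; apply: eq_bigr => i /e_out ->.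
rewrite /digit_count supp_e big_fsetU1 //= eE eqxx oddD /=; congr (~~ odd _).
by rewrite big_seq [RHS]big_seq; apply: eq_bigr => i /e_out ->.
Qed.

Definition represents_word (lo hi : int) (v : R) (w : seq bool) : Prop :=
  forall i, (i < size w)%N -> represents lo hi (v + i%:R) (nth false w i).

Lemma represents_word_cat lo hi v w1 w2 :
    represents_word lo hi v w1 ->
    represents_word lo hi (v + (size w1)%:R) w2 ->
  represents_word lo hi v (w1 ++ w2).
Proof.
move=> w1P w2P i; rewrite size_cat nth_cat; case: (ltnP i (size w1)) => [ltiw _|leiw lti].
  exact: w1P.
have -> : v + i%:R = v + (size w1)%:R + (i - size w1)%:R.
  by rewrite -addrA -natrD subnKC.
by apply: w2P; lia.
Qed.

Lemma represents_word_widen lo hi lo' hi' v w :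
    lo' <= lo -> hi <= hi' ->
  represents_word lo hi v w -> represents_word lo' hi' v w.
Proof. by move=> le_lo le_hi wP i /wP; apply: represents_widen. Qed.

Lemma represents_word_insert k lo hi v w :
    represents_word lo hi v w -> k + 2 <= lo \/ hi + 2 <= k ->
  represents_word (Order.min lo k) (Order.max hi k) (v + phi ^ k)
    (map negb w).
Proof.
move=> wP k_out i; rewrite size_map => lti; rewrite (nth_map false) // addrAC.
exact: represents_insert (wP i lti) k_out.
Qed.

(** * The recursion on Lucas intervals *)

(** For even h the sizes are 1 + L_(h+1), L_h - 1 and 1 + L_(h-1).  The words
    list the parities on [0, L_(h+1)], those of the inner parts k - phi^(-h) for
    0 < k < L_h, and those on [0, L_(h-1)].  The parity of an inner part is that
    of the integer L_(h+1) + k, whose expansion has two more digits 1. *)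
Record block_words_at (h : int) (W : block -> seq bool) : Prop := BlockWordsAt {
  low_represents : represents_word (- h) h 0 (W LowBlock);
  core_represents :
    represents_word (- (h - 1)) (h - 1) (1 - phi ^ (- h)) (W CoreBlock);
  previous_represents :
    represents_word (- (h - 2)) (h - 2) 0 (W PreviousBlock);
  size_low : (size (W LowBlock))%:R = 1 + phi ^ (h + 1) - phi ^ (- (h + 1));
  size_core : (size (W CoreBlock))%:R = phi ^ h + phi ^ (- h) - 1;
  size_previous :
    (size (W PreviousBlock))%:R = 1 + phi ^ (h - 1) - phi ^ (- (h - 1))
}.

Lemma block_words_next (h : int) W :
  0 <= h -> block_words_at h W -> block_words_at (h + 2) (next_words W).
Proof.
move=> h_ge0 [lowP coreP prevP low_size core_size prev_size].
have r1 : phi ^ (h + 1) = phi ^ h + phi ^ (h - 1).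
  by apply: golden_mean_exp_rec; lia.
have r2 : phi ^ (h + 2) = phi ^ (h + 1) + phi ^ h.
  by apply: golden_mean_exp_rec; lia.
have r3 : phi ^ (h + 2 + 1) = phi ^ (h + 2) + phi ^ (h + 1).
  by apply: golden_mean_exp_rec; lia.
have s1 : phi ^ (- (h - 1)) = phi ^ (- h) + phi ^ (- (h + 1)).
  by apply: golden_mean_exp_rec; lia.
have s2 : phi ^ (- h) = phi ^ (- (h + 1)) + phi ^ (- (h + 2)).
  by apply: golden_mean_exp_rec; lia.
have s3 : phi ^ (- (h + 1)) = phi ^ (- (h + 2)) + phi ^ (- (h + 2 + 1)).
  by apply: golden_mean_exp_rec; lia.
have [lowE coreE prevE] := next_wordsE W.
have hE1 : h + 2 - 1 = h + 1 by lia.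
have hE2 : h + 2 - 2 = h by lia.
(* Two digits 1, one on each side of the window, leave the parity unchanged. *)
have two_digits k l lo hi v w :
    represents_word lo hi v w -> l + 2 <= lo -> hi + 2 <= k -> l + 2 <= k ->
    represents_word (Order.min lo l) (Order.max hi k) (v + phi ^ k + phi ^ l) w.
  move=> wP lo_l hi_k lk.
  have := @represents_word_insert l _ _ _ _
    (represents_word_insert wP (or_intror hi_k)).
  have -> : map negb (map negb w) = w.
    by rewrite -map_comp -[RHS]map_id; apply: eq_map => -[].
  by move=> wlP; apply: represents_word_widen (wlP _); lia.
split; rewrite ?hE1 ?hE2.
- rewrite lowE catA.
  apply: represents_word_cat; first apply: represents_word_cat.
  + by apply: represents_word_widen lowP; lia.
  + have := two_digits (h + 1) (- (h + 2)) _ _ _ _ coreP.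
    rewrite (_ : 1 - _ + _ + _ = 0 + (size (W LowBlock))%:R); last by lra.
    by move=> wP; apply: represents_word_widen (wP _ _ _); lia.
  have := two_digits (h + 2) (- (h + 2)) _ _ _ _ lowP.
  rewrite size_cat natrD.
  rewrite (_ : 0 + _ + _ =
    0 + ((size (W LowBlock))%:R + (size (W CoreBlock))%:R));
    last by lra.
  by move=> wP; apply: represents_word_widen (wP _ _ _); lia.
- rewrite coreE catA.
  apply: represents_word_cat; first apply: represents_word_cat.
  + (* k - phi^(-(h+2)) = (k - phi^(-h)) + phi^(-(h+1)) *)
    have := @represents_word_insert (- (h + 1)) _ _ _ _ coreP.
    rewrite (_ : 1 - _ + _ = 1 - phi ^ (- (h + 2))); last by lra.
    by move=> wP; apply: represents_word_widen (wP _); lia.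
  + (* L_h + j - phi^(-(h+2)) = phi^h + j + phi^(-(h+1)) *)
    have [h0|h_gt0] : h = 0 \/ 1 <= h by lia.
      (* For h = 0 the positions h and - (h + 1) are adjacent, but then the
         previous block is empty. *)
      have: (size (W PreviousBlock))%:R == 0 :> R.
        rewrite prev_size.
        have -> : - (h - 1) = h + 1 by lia.
        by rewrite r1 h0 expr0z; apply/eqP; ring.
      by rewrite pnatr_eq0 size_eq0 => /eqP -> [].
    have := two_digits h (- (h + 1)) _ _ _ _ prevP.
    rewrite size_map (_ : 0 + _ + _ =
      1 - phi ^ (- (h + 2)) + (size (W CoreBlock))%:R); last by lra.
    by move=> wP; apply: represents_word_widen (wP _ _ _); lia.
  (* L_(h+1) + k - phi^(-(h+2)) = (k - phi^(-h)) + phi^(h+1) *)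
  have := @represents_word_insert (h + 1) _ _ _ _ coreP.
  rewrite size_cat size_map natrD.
  rewrite (_ : 1 - _ + _ = 1 - phi ^ (- (h + 2)) +
    ((size (W CoreBlock))%:R + (size (W PreviousBlock))%:R)); last by lra.
  by move=> wP; apply: represents_word_widen (wP _); lia.
- by rewrite prevE.
- rewrite lowE !size_cat !natrD.
  by lra.
- by rewrite coreE !size_cat !size_map !natrD; lra.
by rewrite prevE.
Qed.

(** Here h = 0: the integers 0 and 1 = L_1, the empty representation of
    1 - phi^0 = 0 (inner part of the expansion of 2), and no integer at all,
    since L_(-1) = -1. *)
Definition initial_words (b : block) : seq bool :=
  match b with
  | LowBlock => [:: false; true] | CoreBlock => [:: false]
  | PreviousBlock => [::]
  end.

Lemma initial_block_words : block_words_at 0 initial_words.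
Proof.
have r : phi = 1 + phi ^ (- 1).
  by rewrite -[LHS]expr1z -(expr0z phi); apply: golden_mean_exp_rec.
split=> //=; last 3 first.
- by rewrite add0r expr1z {1}r addrA addrK -natr1.
- by rewrite oppr0 expr0z addrK.
- by rewrite sub0r opprK expr1z {2}r subrr.
- move=> [|[|//]] _ /=; first by rewrite addr0; apply: represents0.
  have := @represents_insert 0 2 (- 2) 0 false (represents0 _ _).
  by rewrite expr0z => /(_ (or_introl isT)); apply: represents_widen; lia.
move=> [|//] _ /=; rewrite oppr0 expr0z subrr addr0; exact: represents0.
Qed.

Lemma iter_block_words n :
  block_words_at (2 * n%:Z) (iter n next_words initial_words).
Proof.
elim: n => [|n IHn]; first by rewrite mulr0; exact: initial_block_words.
rewrite iterS (_ : 2 * n.+1%:Z = 2 * n%:Z + 2); last lia.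
by apply: block_words_next => //; lia.
Qed.

End BasePhi.

Theorem mainTheorem1 (R : realType) : morphic (x_beta R).
Proof.
(* One step is needed from the initial words, where a block is empty. *)
pose W := next_words initial_words.
apply: (@morphic_image _ block_morphism (signed_word W) _ (LowBlock, false)) => //.
  by move=> [[] []].
move=> n; cbv zeta; rewrite signed_word_iter /= cats0 signed_word_false.
split; first exact: size_iter_next_words.
rewrite /W -iterSr; set w := iter _ _ _ _.
apply: (@eq_from_nth _ false) => [|i lti]; first by rewrite size_mkseq.
rewrite nth_mkseq //.
have /(_ i lti) := low_represents (iter_block_words R n.+1).
by rewrite add0r => /x_beta_represents ->.
Qed.
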